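(* Let $E$ be a field of characteristic zero. Then $E$ has infinitely many maximal subrings up to isomorphism.
   Context: All rings are commutative with $1\neq 0$; subrings and homomorphisms are unital. A proper subring $S$ of a ring $R$ is a maximal subring of $R$ if it is maximal with respect to inclusion among the proper subrings of $R$ (it may or may not be a field). ''Up to isomorphism'' means that maximal subrings are counted up to ring isomorphism, i.e. one counts isomorphism classes. *)

(* Defs.v *)
From HB Require Import structures.
From mathcomp Require Import all_boot all_algebra.
From mathcomp Require Import boolp classical_sets functions cardinality.

Set Implicit Arguments.
Unset Strict Implicit.
Unset Printing Implicit Defensive.

Import GRing.Theory.
Local Open Scope ring_scope.
Local Open Scope classical_set_scope.

(* The subrings of R are the terms S : subringClosed R. The underlying        *)
(* predicate is boolean, which is no restriction in the presence of the       *)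
(* classical axioms of boolp: any P : R -> Prop is reflected by `[< P x >].   *)

Section MaximalSubrings.
Variable R : comNzRingType.

Definition subring_type (S : subringClosed R) : Type := {x : R | x \in S}.

HB.instance Definition _ (S : subringClosed R) :=
  SubChoice.copy (subring_type S) {x : R | x \in S}.
HB.instance Definition _ (S : subringClosed R) :=
  [SubChoice_isSubComNzRing of subring_type S by <:].

Definition proper_subring (S : subringClosed R) : Prop :=
  exists x, x \notin S.

Definition maximal_subring (S : subringClosed R) : Prop :=
  proper_subring S /\
  forall T : subringClosed R,
    proper_subring T -> {subset S <= T} -> T =i S.

Definition subring_iso (S T : subringClosed R) : Prop :=
  exists f : {rmorphism subring_type S -> subring_type T}, bijective f.

Definition maximal_subring_class (S : subringClosed R) :
    set (subringClosed R) :=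
  [set T | maximal_subring T /\ subring_iso S T].

Definition maximal_subring_classes : set (set (subringClosed R)) :=
  [set maximal_subring_class S | S in maximal_subring].

End MaximalSubrings.

Arguments maximal_subring_classes : clear implicits.

(* Main.v *)
Require Import Defs.
From HB Require Import structures.
From mathcomp Require Import all_boot all_algebra.
From mathcomp Require Import boolp classical_sets functions cardinality.

(* For each prime p, Zorn's lemma yields a subring S that is maximal among the
   subrings not containing 1/p whose localization S[1/p] is a field. Such an S
   is integrally closed in E and is a valuation ring of S[1/p]. If some x in E
   were transcendental over S, the Gauss extension of S to S[1/p](x) would
   contradict maximality; so E is algebraic over S, and integral closedness
   gives S[1/p] = E. Any proper subring T containing S then omits 1/p, so T = S
   by maximality: S is a maximal subring. Since p is the only prime that is not
   invertible in S, different primes give non-isomorphic maximal subrings. *)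

Set Implicit Arguments.
Unset Strict Implicit.
Unset Printing Implicit Defensive.

Import GRing.Theory.
Local Open Scope ring_scope.

(** * Bundling predicates closed under the ring operations *)

Section PackedSubring.
Variables (R : pzRingType) (S : {pred R}) (ringS : subring_closed S).

Definition packed_subring : {pred R} := fun x => x \in S.

Lemma packed_subring_closed : subring_closed packed_subring.
Proof. exact: ringS. Qed.

HB.instance Definition _ :=
  GRing.isSubringClosed.Build R packed_subring packed_subring_closed.

Definition subring_of : subringClosed R := packed_subring.

Lemma mem_subring_of : subring_of =i S.
Proof. by []. Qed.

End PackedSubring.

(** * Subrings omitting [pi^-1] and their maximal elements *)

Section Good.
Variables (E : fieldType) (pi : E).

(* The last condition says that S[1/pi] is a field. *)
Definition good (S : {pred E}) : Prop :=
  [/\ subring_closed S, pi \in S, pi^-1 \notin S &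
      forall y, y \in S -> y != 0 -> exists n, pi ^+ n / y \in S].

Section MaxGood.
Variable S : subringClosed E.
Hypothesis goodS : good S.
Hypothesis maxS : forall T : {pred E},
  good T -> {subset S <= T} -> {subset T <= S}.

Let piS : pi \in S. Proof. by case: goodS. Qed.
Let piVS : pi^-1 \notin S. Proof. by case: goodS. Qed.

Let pi_neq0 : pi != 0.
Proof. by apply: contraNneq piVS => ->; rewrite invr0 rpred0. Qed.

(** Localizing [S] at the elements [1 - pi * b] gives a good subring, so by maximality they are
    already units. It omits [pi^-1] because [(1 - pi * b) / pi] is [pi^-1 - b]. *)
Lemma one_sub_pi_unit a : a \in S -> (1 - pi * a)^-1 \in S.
Proof.
have ringS : subring_closed S by case: goodS.
pose T : {pred E} := fun y => `[< exists2 a, a \in S &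
  (1 - pi * a) * y \in S >].
have TP y : reflect (exists2 a, a \in S & (1 - pi * a) * y \in S) (y \in T).
  exact: asboolP.
have ST : {subset S <= T}.
  by move=> y yS; apply/TP; exists 0; rewrite ?rpred0 // mulr0 subr0 mul1r.
have neq0 b : b \in S -> 1 - pi * b != 0.
  move=> bS; apply: contraNneq piVS => /eqP; rewrite subr_eq0 => /eqP e.
  by rewrite -[pi^-1]mulr1 e mulKf.
have mulS b c : b \in S -> c \in S -> exists2 d, d \in S &
    (1 - pi * b) * (1 - pi * c) = 1 - pi * d.
  move=> bS cS; exists (c + b * (1 - pi * c)).
    by rewrite rpredD ?rpredM ?rpredB ?rpred1 ?rpredM.
  by rewrite mulrBl mul1r (mulrDr pi c) opprD addrA mulrA.
move=> aS; apply: (@maxS T) => //; last first.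
  by apply/TP; exists a => //; rewrite mulfV ?rpred1 // neq0.
split; [split | | | ].
- exact/ST/rpred1.
- move=> x y /TP[b bS bx] /TP[c cS cy]; apply/TP.
  have [d dS e] := mulS _ _ bS cS; exists d => //; rewrite -e.
  rewrite (_ : _ * _ = (1 - pi * c) * ((1 - pi * b) * x)
                       - (1 - pi * b) * ((1 - pi * c) * y)); last first.
    by rewrite mulrBr {1}(mulrC (1 - pi * b)) -!mulrA.
  by rewrite rpredB // rpredM // rpredB ?rpred1 ?rpredM.
- move=> x y /TP[b bS bx] /TP[c cS cy]; apply/TP.
  have [d dS e] := mulS _ _ bS cS; exists d => //; rewrite -e.
  by rewrite mulrACA rpredM.
- exact: ST.
- apply/negP => /TP[b bS]; rewrite mulrBl mul1r mulrAC divff // mul1r => h.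
  by move: piVS; rewrite -[pi^-1](subrK b) rpredD.
- move=> y /TP[b bS by_] y0; case: goodS => _ _ _ /(_ _ by_).
  rewrite mulf_neq0 ?neq0 // => /(_ isT) [n hn]; exists n.
  apply/ST; rewrite (_ : _ / _ = (1 - pi * b) * (pi ^+ n / ((1 - pi * b) * y))).
    by rewrite rpredM // rpredB ?rpred1 ?rpredM.
  by rewrite invfM mulrCA (mulrA (1 - _)) mulfV ?neq0 // mul1r.
Qed.

(** * Integral closedness *)

Local Notation SE := (val : subring_type S -> E).

Lemma polyOver_map (f : {poly E}) : f \is a polyOver S ->
  exists g : {poly subring_type S}, map_poly SE g = f.
Proof.
move=> /polyOverP fS;
  exists (\poly_(i < size f) (Sub f`_i (fS i) : subring_type S)).
apply/polyP => i; rewrite coef_map coef_poly.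
case: ltnP => hi; first by [].
by rewrite raddf0 nth_default.
Qed.

Lemma map_polyOver (g : {poly subring_type S}) : map_poly SE g \is a polyOver S.
Proof. by apply/polyOverP => i; rewrite coef_map; apply: valP. Qed.

(** This form keeps all polynomials over [E] rather than over the subtype. *)
Lemma integralOverP x : integralOver SE x <->
  exists f : {poly E}, [/\ f \is monic, f \is a polyOver S & root f x].
Proof.
split=> [[g mg rg]|[f [mf /polyOver_map[g gf] rf]]].
  exists (map_poly SE g); split=> //; first exact: monic_map.
  exact: map_polyOver.
rewrite -{f}gf in mf rf; exists g => //; move: mf; rewrite !monicE.
rewrite (_ : lead_coef (map_poly SE g) = SE (lead_coef g)).
  by move/eqP => e; apply/eqP/val_inj.
by apply: lead_coef_map_inj; [exact: val_inj | exact: raddf0].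
Qed.

Lemma integralOver_id x : x \in S -> integralOver SE x.
Proof. by move=> xS; rewrite -[x]/(SE (Sub x xS)); apply: integral_id. Qed.

Lemma integralOver_horner (f : {poly E}) x :
  f \is a polyOver S -> integralOver SE x -> integralOver SE f.[x].
Proof.
move=> /polyOverP fS; apply: integral_horner.
by apply/integral_poly => i; apply: integralOver_id.
Qed.

Lemma polyOver_drop n (f : {poly E}) :
  f \is a polyOver S -> drop_poly n f \is a polyOver S.
Proof.
by move/polyOverP=> fS; apply/polyOverP => i; rewrite coef_drop_poly.
Qed.

(** Multiplying a monic equation of degree [n.+1] for [pi^-1] by [pi ^+ n] would put [pi^-1] into
    [S]. *)
Lemma piV_not_integral : ~ integralOver SE pi^-1.
Proof.
move=> /integralOverP[f [mf /polyOverP fS /rootP]].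
rewrite horner_coef; case e: (size f) => [|[|n]].
- by move: (monic_neq0 mf); rewrite -size_poly_eq0 e.
- rewrite big_ord1 expr0 mulr1 => f0; move: (monicP mf).
  by rewrite lead_coefE e f0 => /esym/eqP; rewrite oner_eq0.
rewrite big_ord_recr /= (_ : f`_n.+1 = 1); last first.
  by rewrite -(monicP mf) lead_coefE e.
rewrite mul1r addrC => /(congr1 ( *%R (pi ^+ n))).
rewrite mulr0 mulrDr exprSr mulrA -exprMn divff // expr1n mul1r => /eqP.
rewrite addr_eq0 => /eqP h; move: piVS; rewrite h rpredN mulr_sumr.
rewrite rpred_sum // => i _; rewrite mulrCA rpredM //.
move: (nat_of_ord i) (leq_ord i) => j /subnK <-.
by rewrite exprD -mulrA -exprMn divff // expr1n mulr1 rpredX.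
Qed.

Lemma horner_split0 (f : {poly E}) x : f.[x] = f`_0 + x * (drop_poly 1 f).[x].
Proof.
rewrite -[in LHS](poly_take_drop 1 f) hornerD hornerM hornerXn expr1 mulrC.
congr (_ + _); rewrite (@horner_coef_wide _ 1) ?size_take_poly //.
by rewrite big_ord1 expr0 mulr1 coef_take_poly.
Qed.

(** The integral closure of [S] in [E] is again good, so maximality applies to it. *)
Lemma integrally_closed x : integralOver SE x -> x \in S.
Proof.
pose T : {pred E} := fun y => `[< integralOver SE y >].
have TP y : reflect (integralOver SE y) (y \in T) by apply: asboolP.
have ST : {subset S <= T} by move=> y yS; apply/TP/integralOver_id.
move/TP; apply: maxS => //; split; [split | | | ].
- exact/ST/rpred1.
- by move=> y z /TP iy /TP iz; apply/TP/integral_sub.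
- by move=> y z /TP iy /TP iz; apply/TP/integral_mul.
- exact: ST.
- exact/TP/piV_not_integral.
move=> y /TP iy y0; case/integralOverP: (iy) => f [mf fS rf].
(* Dividing the equation by a power of [y] makes its constant term nonzero. Then [y^-1] is an
   integral element divided by that term, and a power of [pi] clears the denominator. *)
have exf : exists i, f`_i != 0.
  by exists (size f).-1; rewrite -lead_coefE lead_coef_eq0 monic_neq0.
case: (ex_minnP exf) => m fm minm; pose q := drop_poly m f.
have qf : f = q * 'X^m.
  rewrite -[LHS](poly_take_drop m) [take_poly _ _](_ : _ = 0) ?add0r //.
  apply/polyP => i; rewrite coef_take_poly coef0; case: ltnP => // im.
  by apply/eqP; apply: contraLR im => /minm; rewrite -leqNgt.
have qS : q \is a polyOver S by apply: polyOver_drop.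
have q0 : q`_0 != 0 by rewrite coef_drop_poly add0n.
have : q.[y] = 0.
  apply/eqP; move/rootP/eqP: rf; rewrite qf hornerM hornerXn mulf_eq0.
  by rewrite expf_eq0 (negPf y0) andbF orbF.
rewrite horner_split0 => /eqP; rewrite addr_eq0 => /eqP h.
have [_ _ _ /(_ _ (polyOverP qS 0) q0)[n hn]] := goodS.
exists n; apply/TP; rewrite (_ : _ / _ =
  - (drop_poly 1 q).[y] * (pi ^+ n / q`_0)).
  apply: integral_mul; last exact: integralOver_id.
  by apply/integral_opp/integralOver_horner => //; apply: polyOver_drop.
by apply: (mulIf y0); rewrite divfK // mulrAC mulNr mulrC [_ * y]mulrC -h divfK.
Qed.

(** * The localization [S[1/pi]] and the valuation property *)

(* The underlying set of S[1/pi]. *)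
Definition loc : {pred E} := fun x => `[< exists n, pi ^+ n * x \in S >].

Lemma locP x : reflect (exists n, pi ^+ n * x \in S) (x \in loc).
Proof. exact: asboolP. Qed.

Lemma sub_loc : {subset S <= loc}.
Proof. by move=> x xS; apply/locP; exists 0; rewrite mul1r. Qed.

Lemma loc_subring : subring_closed loc.
Proof.
split; first exact/sub_loc/rpred1.
- move=> x y /locP[n xS] /locP[m yS]; apply/locP; exists (n + m)%N.
  rewrite mulrBr {1}addnC !exprD -!mulrA.
  by rewrite rpredB // rpredM ?rpredX.
- move=> x y /locP[n xS] /locP[m yS]; apply/locP; exists (n + m)%N.
  by rewrite exprD mulrACA rpredM.
Qed.

Lemma loc_div a b : a \in S -> b \in S -> a / b \in loc.
Proof.
move=> aS bS; have [->|b0] := eqVneq b 0;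
  first by rewrite invr0 mulr0 sub_loc ?rpred0.
have [_ _ _ /(_ _ bS b0)[n hn]] := goodS.
by apply/locP; exists n; rewrite mulrCA rpredM.
Qed.

Lemma loc_inv x : x \in loc -> x^-1 \in loc.
Proof.
move=> /locP[n xS].
rewrite (_ : x^-1 = pi ^+ n / (pi ^+ n * x)) ?loc_div ?rpredX //.
by rewrite invfM mulVKf ?expf_neq0.
Qed.

(** Such a [T] is good: for nonzero [y] in [T] some [pi ^+ n * y] lies in [S], and the last
    condition for that element gives the one for [y]. *)
Lemma intermediate_eq (T : {pred E}) :
  subring_closed T -> {subset S <= T} -> {subset T <= loc} -> pi^-1 \notin T ->
  {subset T <= S}.
Proof.
move=> ringT ST Tloc piT; apply: maxS => //; split=> //; first exact: ST.
move=> y yT y0; have [n nyS] := locP _ (Tloc _ yT).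
have ny0 : pi ^+ n * y != 0 by rewrite mulf_neq0 ?expf_neq0.
have [_ _ _ /(_ _ nyS ny0)[k hk]] := goodS; exists k.
have TM : {in T &, forall u v, u * v \in T} by case: ringT.
rewrite (_ : _ / _ = pi ^+ n * (pi ^+ k / (pi ^+ n * y))).
  by rewrite TM // ST // rpredX.
by rewrite invfM mulrCA mulVKf ?expf_neq0.
Qed.

(** Otherwise [S[x]] would be a subring of [S[1/pi]] omitting [pi^-1], hence equal to [S]. *)
Lemma adjoin_piV x : x \in loc -> x \notin S ->
  exists2 f, f \is a polyOver S & pi * f.[x] = 1.
Proof.
move=> xloc xS; apply: contrapT => nf; case/negP: xS.
pose T : {pred E} :=
  fun y => `[< exists2 f : {poly E}, f \is a polyOver S & y = f.[x] >].
have TP y : reflect (exists2 f : {poly E}, f \is a polyOver S & y = f.[x])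
    (y \in T).
  exact: asboolP.
apply: (@intermediate_eq T).
- split; first by apply/TP; exists 1; rewrite ?rpred1 // hornerE.
    move=> y z /TP[f fS ->] /TP[g gS ->]; apply/TP.
    by exists (f - g); rewrite ?rpredB // !hornerE.
  move=> y z /TP[f fS ->] /TP[g gS ->]; apply/TP.
  by exists (f * g); rewrite ?rpredM // !hornerE.
- by move=> y yS; apply/TP; exists y%:P; rewrite ?polyOverC ?hornerC.
- move=> y /TP[f /polyOverP fS ->]; rewrite -(mem_subring_of loc_subring).
  rewrite rpred_horner //; apply/polyOverP => i.
  by rewrite mem_subring_of sub_loc.
- by apply/negP => /TP[f fS e]; apply: nf; exists f => //; rewrite -e mulfV.
- by apply/TP; exists 'X; rewrite ?polyOverX ?hornerX.
Qed.

Lemma horner_rev (f : {poly E}) n x : x != 0 -> (size f <= n.+1)%N ->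
  x ^+ n * f.[x^-1] = (\poly_(k < n.+1) f`_(n - k)).[x].
Proof.
move=> x0 sf; rewrite horner_poly (horner_coef_wide _ sf) mulr_sumr.
rewrite (reindex_inj rev_ord_inj); apply: eq_bigr => i _ /=.
rewrite subSS mulrCA; congr (_ * _); move: (nat_of_ord i) (leq_ord i) => j jn.
by rewrite -{1}(subnK jn) exprD mulrAC exprVn mulfV ?mul1r // expf_neq0.
Qed.

(* Chevalley's argument: of two relations for x and 1/x, the one of larger
   degree can be shortened by means of the other. *)
Lemma no_piV_both x (f g : {poly E}) : x != 0 ->
  f \is a polyOver S -> g \is a polyOver S ->
  pi * f.[x] = 1 -> pi * g.[x^-1] = 1 -> False.
Proof.
have [k] := ubnP (size f + size g).
elim: k x f g => // k IH x f g lek x0 fS gS fx gx.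
wlog gf : x f g lek x0 fS gS fx gx / (size g <= size f)%N.
  move=> W; case/orP: (leq_total (size g) (size f)) => [|fg];
    first exact: (W x f g).
  by apply: (W x^-1 g f); rewrite ?invrK ?invr_eq0 // addnC.
have f0 : f != 0.
  by apply: contra_eq_neq fx => ->; rewrite horner0 mulr0 eq_sym oner_eq0.
(* Splitting off the constant term of [g] leaves the unit [1 - pi * g.[0]] on one side; dividing by
   it writes 1 as a combination of positive powers of [x^-1]. *)
have := gx; rewrite horner_split0 mulrDr => /(canRL (addKr _)).
rewrite addrC => e1.
have gS0 : g`_0 \in S by apply/polyOverP.
have uS := one_sub_pi_unit gS0; set u := (1 - pi * g`_0)^-1 in uS.
have u0 : 1 - pi * g`_0 != 0.
  apply: contraNneq piVS => /eqP; rewrite subr_eq0 => /eqP e.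
  by rewrite -[pi^-1]mulr1 e mulKf.
have {}e1 : 1 = u * (pi * (x^-1 * (drop_poly 1 g).[x^-1])) by rewrite e1 mulVf.
have sg : (size (drop_poly 1 g) <= (size f).-1)%N.
  by rewrite size_drop_poly subn1 -!subn1 leq_sub2r.
have sf : size f = (size f).-1.+1 by rewrite polySpred.
case eN : (size f).-1 => [|N] in sg sf.
  move: sg; rewrite leqn0 size_poly_eq0 => /eqP dg.
  by move/eqP: e1; rewrite dg horner0 !mulr0 oner_eq0.
(* Reversing coefficients expresses [x ^+ N.+1] through lower powers of [x], and this replaces the
   leading term of [f]. *)
pose r := \poly_(k < N.+1) (drop_poly 1 g)`_(N - k).
have xN : x ^+ N.+1 = u * pi * r.[x].
  rewrite -horner_rev // -[LHS]mulr1 e1 exprSr -!mulrA [x * _]mulrCA.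
  by rewrite [x * (pi * _)]mulrCA mulVKf // 2!(mulrCA (x ^+ N)).
pose f' := take_poly N.+1 f + (f`_N.+1 * (u * pi)) *: r.
have f'x : f'.[x] = f.[x].
  rewrite -[f in RHS](poly_take_drop N.+1) /f' !hornerD hornerZ -mulrA -xN.
  rewrite hornerM hornerXn (_ : drop_poly _ _ = (f`_N.+1)%:P) ?hornerC //.
  apply/polyP => i; rewrite coef_drop_poly coefC.
  by case: i => // i; rewrite nth_default // sf addSn ltnS leq_addl.
have rS : r \is a polyOver S.
  by apply/polyOver_poly => i _; apply/polyOverP/polyOver_drop.
apply: (IH x f' g) => //.
- rewrite -ltnS; apply: leq_trans lek; rewrite ltnS ltn_add2r sf ltnS.
  apply: leq_trans (size_polyD _ _) _; rewrite geq_max size_take_poly /=.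
  exact: leq_trans (size_scale_leq _ _) (size_poly _ _).
- apply: rpredD; first by apply: polyOver_poly => i _; apply/polyOverP.
  by rewrite polyOverZ // !rpredM //; apply/polyOverP.
- by rewrite f'x.
Qed.

(** If neither held, both [S[x]] and [S[1/x]] would contain [pi^-1], which Chevalley's argument
    excludes. *)
Lemma loc_valuation x : x \in loc -> (x \in S) \/ (x^-1 \in S).
Proof.
move=> xl; have [->|x0] := eqVneq x 0; first by left; rewrite rpred0.
have [xS|nxS] := boolP (x \in S); first by left.
have [xS|nxVS] := boolP (x^-1 \in S); first by right.
have [f fS fx] := adjoin_piV xl nxS.
have [g gS gx] := adjoin_piV (loc_inv xl) nxVS.
by case: (no_piV_both x0 fS gS fx gx).
Qed.

(** * Units of [S], Gauss's lemma and contents *)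

(** For [a] in [S] this means a unit of [S]; [a != 0] is explicit because the inverse of 0 is 0,
    which lies in [S]. *)
Definition unit_in (a : E) : bool := (a != 0) && (a^-1 \in S).

Lemma unit_inMl a b : b \in S -> unit_in (a * b) -> unit_in a.
Proof.
move=> bS /andP[]; rewrite mulf_eq0 negb_or => /andP[a0 b0].
by rewrite /unit_in a0 => /(rpredM bS); rewrite invfM mulrCA mulfV // mulr1.
Qed.

Lemma unit_inM a b : unit_in a -> unit_in b -> unit_in (a * b).
Proof.
move=> /andP[a0 aS] /andP[b0 bS].
by rewrite /unit_in mulf_neq0 // invfM rpredM.
Qed.

(** So [S] is local. By the valuation property one may take [a / b] in [S]; then [b] divides the
    unit [a + b]. *)
Lemma unit_inD a b : a \in S -> b \in S -> unit_in (a + b) ->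
  unit_in a || unit_in b.
Proof.
wlog : a b / a / b \in S => [W aS bS abu|abS aS bS /andP[ab0 abVS]].
  have [/W|] := loc_valuation (loc_div aS bS); first exact.
  by rewrite invf_div orbC => /W; apply=> //; rewrite addrC.
have [b0|b0] := eqVneq b 0; first by rewrite b0 addr0 in ab0 abVS;
  rewrite /unit_in ab0 abVS.
rewrite /unit_in b0 (_ : b^-1 = (a / b + 1) / (a + b)) ?orbT.
  by rewrite rpredM ?rpredD ?rpred1 ?orbT.
by rewrite -[1](divff b0) -mulrDl mulrAC divff // mul1r.
Qed.

(** Over the local ring [S] a unit coefficient is equivalent to content 1. *)
Definition primitive (g : {poly E}) := exists i, unit_in g`_i.

(** Gauss's lemma: if [i] and [j] are the first positions of unit coefficients, the coefficient of
    [f * g] at [i + j] is a unit plus a sum of nonunits. *)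
Lemma primitiveM f g : f \is a polyOver S -> g \is a polyOver S ->
  primitive f -> primitive g -> primitive (f * g).
Proof.
move=> /polyOverP fS /polyOverP gS pf pg.
case: (ex_minnP pf) => i fi mi; case: (ex_minnP pg) => j gj mj.
exists (i + j)%N; rewrite coefM.
have ij : (i < (i + j).+1)%N by rewrite ltnS leq_addr.
rewrite (bigD1 (Ordinal ij)) //= addKn.
set r := (X in _ + X).
have [rS nr] : r \in S /\ ~~ unit_in r.
  apply: (big_ind (fun z => z \in S /\ ~~ unit_in z)).
  - by rewrite rpred0 /unit_in eqxx.
  - move=> y z [yS ny] [zS nz]; rewrite rpredD //; split=> //.
    by apply/negP => /(unit_inD yS zS); rewrite (negPf ny) (negPf nz).
  move=> l nli; rewrite rpredM //; split=> //.
  have : (l : nat) != i by apply: contra nli => /eqP e; apply/eqP/val_inj.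
  rewrite neq_ltn => /orP[li|il]; apply/negP.
    by move/unit_inMl => /(_ (gS _)) /mi; rewrite leqNgt li.
  rewrite mulrC => /unit_inMl => /(_ (fS _)) /mj; rewrite leqNgt => /negP;
    apply.
  by rewrite ltn_subLR ?ltn_add2r // -ltnS ltn_ord.
have fgS : f`_i * g`_j \in S by rewrite rpredM.
have : unit_in (f`_i * g`_j + r - r) by rewrite addrK unit_inM.
move/unit_inD; rewrite rpredD // rpredN => /(_ isT rS) /orP[//|].
by rewrite /unit_in oppr_eq0 invrN rpredN => h; move: nr; rewrite /unit_in h.
Qed.

(** Divisibility is total in a valuation ring, so a finite list has a member dividing all the
    others. *)
Lemma seq_content (s : seq E) :
    {subset s <= S} -> (exists2 a, a \in s & a != 0) ->
  exists c, [/\ c \in s, c != 0 & {in s, forall d, d / c \in S}].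
Proof.
elim: s => [|a s IH] sS [b bs b0]; first by [].
have aS : a \in S by rewrite sS ?mem_head.
have [|sz] := pselect (exists2 a, a \in s & a != 0).
  case/IH => [d ds|c [cs c0 hc]]; first by rewrite sS // inE ds orbT.
  have cS : c \in S by rewrite sS // inE cs orbT.
  have [acS|] := loc_valuation (loc_div aS cS).
    exists c; split; rewrite ?inE ?cs ?orbT // => d; rewrite inE.
    by case/predU1P => [->|/hc].
  rewrite invf_div; have [->|a0] := eqVneq a 0 => caS.
    exists c; split; rewrite ?inE ?cs ?orbT // => d; rewrite inE.
    by case/predU1P => [->|/hc //]; rewrite mul0r rpred0.
  exists a; split; rewrite ?mem_head // => d; rewrite inE.
  case/predU1P => [->|/hc dc]; first by rewrite divff ?rpred1.
  by rewrite -[d](divfK c0) -mulrA rpredM.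
have z d : d \in s -> d = 0.
  by move=> ds; apply/eqP; apply/negPn/negP => d0; apply: sz; exists d.
move: bs b0; rewrite inE => /predU1P[->|/z ->]; last by rewrite eqxx.
move=> a0; exists a; split; rewrite ?mem_head // => d; rewrite inE.
by case/predU1P => [->|/z ->]; rewrite ?mul0r ?rpred0 // divff ?rpred1.
Qed.

Lemma poly_content (f : {poly E}) : f \is a polyOver S -> f != 0 ->
  exists c g,
    [/\ c \in S, c != 0, g \is a polyOver S, primitive g & f = c *: g].
Proof.
move=> /polyOverP fS f0.
have sS : {subset (f : seq E) <= S} by move=> _ /(nthP 0)[i _ <-].
have [|c [cf c0 hc]] := seq_content sS.
  by exists (lead_coef f); rewrite ?lead_coef_eq0 // mem_nth // prednK //
    size_poly_gt0.
have [i _ fi] := nthP 0 cf.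
exists c, (c^-1 *: f); split=> //; first exact: sS.
- apply/polyOverP => j; rewrite coefZ mulrC.
  have [lj|lj] := ltnP j (size f); first by rewrite hc ?mem_nth.
  by rewrite nth_default // mul0r rpred0.
- by exists i; rewrite coefZ fi mulVf // /unit_in oner_eq0 invr1 rpred1.
- by rewrite scalerA divff // scale1r.
Qed.

(** * Algebraicity of [E] over [S], and maximality *)

(* Otherwise the Gauss extension of S to the rational functions in x would
   be a strictly larger good subring. *)
Lemma algebraic_over x :
  exists f : {poly E}, [/\ f \is a polyOver S, f != 0 & root f x].
Proof.
apply: contrapT => ntr.
have tr f : f \is a polyOver S -> f.[x] = 0 -> f = 0.
  move=> fS /rootP rf; apply/eqP/negPn/negP => f0; apply: ntr.
  by exists f.
(* [Q] writes [y] as a fraction [f.[x] / g.[x]] with [g] primitive; [T] is the Gauss extension. *)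
pose Q y (f g : {poly E}) :=
  [/\ f \is a polyOver S, g \is a polyOver S, primitive g & y * g.[x] = f.[x]].
pose T : {pred E} := fun y => `[< exists f g, Q y f g >].
have TP y : reflect (exists f g, Q y f g) (y \in T) by apply: asboolP.
have prim1 : primitive 1 by exists 0;
  rewrite coef1 /unit_in oner_eq0 invr1 rpred1.
have horT f : f \is a polyOver S -> f.[x] \in T.
  by move=> fS; apply/TP; exists f, 1; split; rewrite ?rpred1 // hornerC mulr1.
have ST : {subset S <= T}.
  by move=> y yS; rewrite -[y](hornerC _ x) horT // polyOverC.
have xT : x \in T by rewrite -[x in x \in _]hornerX horT ?polyOverX.
have prim0 g : g \is a polyOver S -> primitive g -> g.[x] != 0.
  move=> gS [i gi]; apply/eqP => /(tr _ gS) g0.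
  by move: gi; rewrite g0 coef0 /unit_in eqxx.
suff /(_ _ xT) xS : {subset T <= S}.
  have : 'X - x%:P = 0 by apply: tr; rewrite ?polyOverXsubC // !hornerE subrr.
  by move/eqP; rewrite polyXsubC_eq0.
apply: maxS => //; split; [split | | | ].
- exact/ST/rpred1.
- move=> y z /TP[f [g [fS gS pg e]]] /TP[f' [g' [fS' gS' pg' e']]]; apply/TP.
  exists (f * g' - f' * g), (g * g'); split; rewrite ?rpredB ?rpredM //.
    exact: primitiveM.
  rewrite hornerD hornerN !hornerM mulrBl -e -e' mulrA; congr (_ - _).
  by rewrite [g.[x] * _]mulrC mulrA.
- move=> y z /TP[f [g [fS gS pg e]]] /TP[f' [g' [fS' gS' pg' e']]]; apply/TP.
  exists (f * f'), (g * g'); split; rewrite ?rpredM //.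
    exact: primitiveM.
  by rewrite !hornerM mulrACA e e'.
- exact: ST.
(* By transcendence, [pi^-1 = f.[x] / g.[x]] forces [g = pi *: f], which has no unit coefficient. *)
- apply/negP => /TP[f [g [fS gS [i gi] e]]].
  have : g - pi *: f = 0.
    apply: tr; first by rewrite rpredB // polyOverZ.
    by rewrite hornerD hornerN hornerZ -e mulVKf // subrr.
  move/eqP; rewrite subr_eq0 => /eqP ge; move: gi; rewrite ge coefZ.
  by move/unit_inMl => /(_ (polyOverP fS i)) /andP[_]; rewrite (negPf piVS).
move=> y /TP[f [g [fS gS pg e]]] y0.
have f0 : f != 0.
  by apply: contraNneq (mulf_neq0 y0 (prim0 _ gS pg)) => f0;
    rewrite e f0 horner0.
(* Only the content [c] of [f] obstructs inverting [y]: [f1] is an admissible denominator, and a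
   power of [pi] clears [c]. *)
have [c [f1 [cS c0 f1S pf1 ff1]]] := poly_content fS f0.
have [_ _ _ /(_ _ cS c0)[n hn]] := goodS.
exists n; apply/TP; exists ((pi ^+ n / c) *: g), f1; split=> //.
  by rewrite polyOverZ.
rewrite hornerZ -!mulrA; congr (_ * _); apply: (mulfI y0).
by rewrite mulVKf // mulrCA e ff1 hornerZ mulKf.
Qed.

(** Multiplying [f.[x] = 0] by [a ^+ n.-1], with [a] the leading coefficient and [n] the degree,
    gives a monic equation over [S] for [a * x]. *)
Lemma lead_integral (f : {poly E}) x : f \is a polyOver S -> f != 0 ->
  root f x ->
  lead_coef f * x \in S.
Proof.
move=> /polyOverP fS f0 /rootP fx; set a := lead_coef f.
have aS : a \in S by apply: fS.
case e: (size f) => [|n]; first by move/eqP: e;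
  rewrite size_poly_eq0 (negPf f0).
have ea : f`_n = a by rewrite /a lead_coefE e.
have n0 : (0 < n)%N.
  rewrite lt0n; apply/eqP => n0; move: fx f0.
  rewrite horner_coef e n0 big_ord1 expr0 mulr1 (_ : f`_ord0 = a) => [/eqP|];
    last by rewrite -ea n0.
  by rewrite lead_coef_eq0 => ->.
apply/integrally_closed/integralOverP.
(* The subtraction [n.-1 - i] is exact for [i < n]; at [i = n], where it would truncate, the
   coefficient is set to 1. *)
pose b i := if i == n then 1 else f`_i * a ^+ (n.-1 - i).
exists (\poly_(i < n.+1) b i); split.
- by rewrite monicE lead_coef_poly /b ?eqxx ?oner_eq0.
- apply: polyOver_poly => i _; rewrite /b; case: eqP => _; first exact: rpred1.
  by rewrite rpredM ?rpredX.
apply/rootP; rewrite horner_poly big_ord_recr /= {2}/b eqxx mul1r.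
have -> : \sum_(i < n) b i * (a * x) ^+ i =
  a ^+ n.-1 * \sum_(i < n) f`_i * x ^+ i.
  rewrite mulr_sumr; apply: eq_bigr => i _; rewrite /b ltn_eqF // exprMn.
  have /subnK {2}<- : (i <= n.-1)%N by rewrite -ltnS prednK.
  by rewrite exprD -!mulrA mulrCA (mulrCA f`_i).
move: fx; rewrite horner_coef e big_ord_recr /= ea => /eqP.
rewrite addr_eq0 => /eqP ->; rewrite mulrN exprMn mulrA -exprSr prednK //.
by rewrite addNr.
Qed.

Lemma loc_full x : x \in loc.
Proof.
have [f [fS f0 rf]] := algebraic_over x.
have axS := lead_integral fS f0 rf.
have aS : lead_coef f \in S by apply/polyOverP.
rewrite -[x](mulKf (_ : lead_coef f != 0)) ?lead_coef_eq0 // mulrC.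
exact: loc_div.
Qed.

Lemma max_good_maximal : maximal_subring S.
Proof.
split; first by exists pi^-1.
move=> T [t tT] ST; have piVT : pi^-1 \notin T.
  apply: contra tT => piT; have [n nt] := locP _ (loc_full t).
  rewrite -[t](mulKf (_ : pi ^+ n != 0)) ?expf_neq0 // -exprVn.
  by rewrite rpredM ?rpredX // ST.
move=> y; apply/idP/idP; last exact: ST.
apply: intermediate_eq => //; last by move=> z _; apply: loc_full.
by split; [exact: rpred1 | move=> ? ?; exact: rpredB | move=> ? ?;
  exact: rpredM].
Qed.

End MaxGood.
End Good.

(** * Existence of maximal good subrings *)

(** Each condition of [good] can be checked inside one member of a nonempty chain, so it passes to
    the union. *)
Lemma ex_max_good (E : fieldType) (pi : E) (S0 : {pred E}) : good pi S0 ->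
  exists S : subringClosed E, good pi S /\
    forall T : {pred E}, good pi T -> {subset S <= T} -> {subset T <= S}.
Proof.
move=> good0; pose bp (A : set E) : {pred E} := fun x => `[< A x >].
have bpP A x : reflect (A x) (x \in bp A) by apply: asboolP.
pose P : set (set E) := fun A => A = set0 \/ good pi (bp A).
have chain (F : set (set E)) : (F `<=` P)%classic -> total_on F subset ->
    P (\bigcup_(X in F) X)%classic.
  move=> Fgood Ftot; set U := (\bigcup_(X in F) X)%classic.
  have [->|/set0P[x0 [X0 FX0 X0x0]]] := eqVneq U set0; [by left | right].
  have gF X x : F X -> X x -> good pi (bp X).
    by move=> /Fgood[-> []|].
  have inU X x : F X -> x \in bp X -> x \in bp U by move=> FX /bpP Xx;
    apply/bpP; exists X.
  have [[one _ _] piX _ _] := gF _ _ FX0 X0x0.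
  have two x y : x \in bp U -> y \in bp U ->
      exists X, [/\ F X, x \in bp X, y \in bp X & good pi (bp X)].
    move=> /bpP[X FX Xx] /bpP[Y FY Yy].
    have [XY|YX] := Ftot _ _ FX FY; [exists Y | exists X].
      by split; [|apply/bpP/XY|apply/bpP|apply: gF Yy].
    by split; [|apply/bpP|apply/bpP/YX|apply: gF Xx].
  split; [split | | | ].
  - exact: inU one.
  - move=> x y xU yU; have [X [FX xX yX [[_ XB _] _ _ _]]] := two _ _ xU yU.
    by apply: (inU X) => //; apply: XB.
  - move=> x y xU yU; have [X [FX xX yX [[_ _ XM] _ _ _]]] := two _ _ xU yU.
    by apply: (inU X) => //; apply: XM.
  - exact: inU piX.
  - apply/negP => /bpP[X FX Xpi]; have [_ _ /negP nX _] := gF _ _ FX Xpi.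
    exact/nX/bpP.
  - move=> y /bpP[X FX Xy] y0; have [_ _ _ /(_ y)] := gF _ _ FX Xy.
    by case=> [|//|n hn]; [exact/bpP | exists n; apply: inU hn].
have [A [PA maxA]] := Zorn_bigcup chain.
have bpS (T : {pred E}) : bp [set x | x \in T]%classic = T.
  by apply/funext => x; apply/idP/idP => [/bpP|? ]; [|apply/bpP].
have maxA' (T : {pred E}) : good pi T -> {subset bp A <= T} ->
    {subset T <= bp A}.
  move=> gT AT;
    have AT' : (A `<=` [set x | x \in T])%classic by move=> x /bpP/AT.
  move=> x xT; apply: contrapT => xA; case: (maxA [set x | x \in T]%classic).
    by split=> // h; apply: xA; apply/bpP/h.
  by right; rewrite bpS.
(* A maximal [A] is nonempty, since [S0] would be larger than the empty set. *)
have gA : good pi (bp A).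
  case: PA => // A0; have [[one _ _] _ _ _] := good0.
  have := maxA' _ good0; rewrite A0 => h.
  by case/(_ _ _ one)/bpP: h => x /bpP.
have rA : subring_closed (bp A) by case: gA.
by exists (subring_of rA).
Qed.

(** * The integers localized at a prime *)

Section LocalizedIntegers.
Variables (E : fieldType) (p : nat).
Hypotheses (charE : [pchar E] =i pred0) (p_pr : prime p).

Definition localized_int : {pred E} := fun x =>
  `[< exists (a : int) (b : nat), ~~ (p %| b)%N /\ x * b%:R = a%:~R >].

Lemma localized_intP x : reflect
  (exists (a : int) (b : nat), ~~ (p %| b)%N /\ x * b%:R = a%:~R)
  (x \in localized_int).
Proof. exact: asboolP. Qed.

Lemma natr_eq0_char0 n : (n%:R == 0 :> E) = (n == 0)%N.
Proof. by move/pcharf0P: charE => ->. Qed.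

Lemma intr_eq0_char0 (a : int) : (a%:~R == 0 :> E) = (a == 0).
Proof.
by case: a => n; rewrite ?NegzE ?rmorphN ?oppr_eq0 /= natr_eq0_char0.
Qed.

Lemma good_localized_int : good p%:R localized_int.
Proof.
have ndvdM b c : ~~ (p %| b)%N -> ~~ (p %| c)%N -> ~~ (p %| b * c)%N.
  by rewrite Euclid_dvdM // negb_or => -> ->.
have ndvd1 : ~~ (p %| 1)%N by rewrite dvdn1 neq_ltn prime_gt1 ?orbT.
split; [split | | | ].
- by apply/localized_intP; exists 1, 1%N; rewrite mulr1.
- move=> x y /localized_intP[a [b [pb xb]]] /localized_intP[c [d [pd yd]]].
  apply/localized_intP; exists (a * d%:Z - c * b%:Z), (b * d)%N; split;
    first exact: ndvdM.
  by rewrite natrM rmorphB !rmorphM /= -xb -yd mulrBl !mulrA (mulrAC y).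
- move=> x y /localized_intP[a [b [pb xb]]] /localized_intP[c [d [pd yd]]].
  apply/localized_intP; exists (a * c), (b * d)%N; split; first exact: ndvdM.
  by rewrite natrM rmorphM /= -xb -yd mulrACA.
- by apply/localized_intP; exists p%:Z, 1%N; rewrite mulr1.
- apply/negP => /localized_intP[a [b [pb e]]].
  have p0 : p%:R != 0 :> E by rewrite natr_eq0_char0 -lt0n prime_gt0.
  have /eqP : (b%:Z - a * p%:Z)%:~R = 0 :> E.
    by rewrite rmorphB rmorphM /= -e mulrAC mulVf // mul1r subrr.
  rewrite intr_eq0_char0 subr_eq0 => /eqP /(congr1 absz); rewrite abszM /= =>
    be.
  by move: pb; rewrite be dvdn_mull.
move=> y /localized_intP[a [b [pb yb]]] y0.
have b0 : b%:R != 0 :> E.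
  by rewrite natr_eq0_char0; apply: contra pb => /eqP ->; rewrite dvdn0.
have a0 : (0 < `|a|)%N.
  by rewrite absz_gt0 -intr_eq0_char0 -yb mulf_neq0.
(* If [|a|] is [m] times a power of [p], with [m] prime to [p], then that power divided by [y] is
   [b / m] up to sign. *)
have [m pm am] := pfactor_coprime p_pr a0.
exists (logn p `|a|); apply/localized_intP; exists ((-1) ^+ (a < 0)%R * b%:Z),
  m.
rewrite -prime_coprime //; split=> //; apply: (mulfI y0).
rewrite mulrA mulrC [y * _]mulrC divfK // -natrX -natrM -am.
by rewrite rmorphM /= mulrCA yb -rmorphM /= -abszEsign.
Qed.

End LocalizedIntegers.

(** * Recovering the prime from the subring *)

(** Bezout gives [u * q = v * p + 1], and [1 + p * v] is a unit of [S] by [one_sub_pi_unit]. *)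
Lemma max_good_natV (E : fieldType) (p : nat) (S : subringClosed E) :
    good p%:R S ->
    (forall T : {pred E}, good p%:R T -> {subset S <= T} -> {subset T <= S}) ->
  forall q, (0 < q)%N -> coprime q p -> q%:R != 0 :> E -> q%:R^-1 \in S.
Proof.
move=> goodS maxS q q_gt0 qp q0; case: (egcdnP p q_gt0) => u v uv _.
move: uv; rewrite (eqP qp) => /(congr1 (fun n => n%:R : E)).
rewrite natrD !natrM => uv.
have vS : - v%:R \in S by rewrite rpredN rpred_nat.
have := one_sub_pi_unit goodS maxS vS.
rewrite mulrN opprK addrC mulrC -uv => /(rpredM (rpred_nat S u)).
(* If [u] vanished in [E], then [- v] would be an inverse of [p] lying in [S]. *)
have [u0|u0] := eqVneq (u%:R : E) 0; last by rewrite invfM mulVKf.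
move: uv; rewrite u0 mul0r => /esym /eqP; rewrite addr_eq0 => /eqP vp.
have [_ _ /negP[]] := goodS.
have p0 : p%:R != 0 :> E by apply: contra_eq_neq vp => ->;
  rewrite mulr0 eq_sym oppr_eq0 oner_eq0.
rewrite (_ : p%:R^-1 = - v%:R) ?rpredN ?rpred_nat //.
by apply: (mulIf p0); rewrite mulVf // mulNr vp opprK.
Qed.

(** A unital homomorphism fixes the multiples of 1, hence preserves their inverses. *)
Lemma subring_iso_natV (E : fieldType) (S T : subringClosed E) n :
  subring_iso S T -> n%:R != 0 :> E -> n%:R^-1 \in S -> n%:R^-1 \in T.
Proof.
move=> [f _] n0 nS; pose u : subring_type S := Sub n%:R^-1 nS.
have un : u * n%:R = 1.
  by apply: val_inj; rewrite rmorphM rmorph_nat rmorph1 /= mulVf.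
have : f u * n%:R = 1 by rewrite -(rmorph_nat f) -rmorphM un rmorph1.
move/(congr1 val); rewrite rmorphM rmorph_nat rmorph1 /=.
by move/(canRL (mulfK n0)); rewrite mul1r => <-; apply: valP.
Qed.

(** * Infinitely many isomorphism classes *)

Lemma infinite_prime : infinite_set [set p : nat | prime p]%classic.
Proof.
move=> /finite_seqP[s es]; have [p] := prime_above (\max_(i <- s) i).
move=> maxp p_pr; have ps : p \in s.
  by have : [set p : nat | prime p]%classic p by []; rewrite es.
by move: maxp; rewrite ltnNge leq_bigmax_seq.
Qed.

Unset Implicit Arguments.

Theorem theorem3p1 (E : fieldType) (hE : [pchar E] =i pred0) :
  infinite_set (maximal_subring_classes E).
Proof.
have n0 n : prime n -> n%:R != 0 :> E.
  by move=> n_pr; rewrite (natr_eq0_char0 hE) -lt0n prime_gt0.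
have /choice[S SP] : forall p, exists S : subringClosed E, prime p ->
    good p%:R S /\
    forall T : {pred E}, good p%:R T -> {subset S <= T} -> {subset T <= S}.
  move=> p; have [p_pr|np] := boolP (prime p); last first.
    (* Any subring serves as default value at a non-prime; here it is the integers localized at
       2. *)
    by exists (subring_of (let: And4 r _ _ _ :=
      good_localized_int hE (isT : prime 2) in r)).
  by have [S SP] := ex_max_good (good_localized_int hE p_pr); exists S.
have maxS p : prime p -> maximal_subring (S p).
  by move=> /SP[gS mS]; apply: max_good_maximal gS mS.
pose c p := maximal_subring_class (S p).
have c_inj : {in [set p : nat | prime p]%classic &, injective c}.
  move=> p q; rewrite !inE /= => p_pr q_pr cpq; apply/eqP/negPn/negP => npq.
  (* Equal classes give an isomorphism from [S p] to [S q]. It carries the inverse of [q], present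
     in [S p], into [S q], which omits it. *)
  have : c q (S q).
    by split; [exact: maxS | exists idfun; exists idfun].
  rewrite -cpq => -[_ /subring_iso_natV /(_ (n0 q q_pr))].
  have [gS mS] := SP p p_pr; have [[_ _ /negP nq _] _] := SP q q_pr.
  move=> h; apply/nq/h; apply: (max_good_natV gS mS); rewrite ?n0 ?prime_gt0 //.
  by rewrite prime_coprime // dvdn_prime2 // eq_sym.
apply: contra_not infinite_prime => fin.
rewrite -(eq_finite_set (inj_card_eq c_inj)); apply: sub_finite_set fin.
by move=> _ [p p_pr <-]; exists (S p) => //; apply: maxS.
Qed.
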